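(* Let $\gamma>0$. Let $(m^*_{ij}),(y^*_{ij})$ be an optimal solution of the correlation clustering LP relaxation written in the form $$\min\ \sum_{i<j}w_{ij}m_{ij}\quad\text{s.t. } y_{ij}-y_{ik}-y_{jk}\le b_{ijk}\ \text{for all } i,j,k,\quad y_{ij}\le m_{ij},\ -y_{ij}\le m_{ij}\ \text{for all } i,j,$$ and let $(\hat m_{ij}),(\hat y_{ij})$ be the optimal solution of the quadratic program that minimizes $$\sum_{i<j}w_{ij}m_{ij}+\frac{1}{2\gamma}\sum_{i<j}w_{ij}m_{ij}^2+\frac{1}{2\gamma}\sum_{i<j}w_{ij}y_{ij}^2$$ subject to the same constraints. Then $$\sum_{i<j}w_{ij}m^*_{ij}\le\sum_{i<j}w_{ij}\hat m_{ij}\le\left(1+\frac1\gamma\right)\sum_{i<j}w_{ij}m^*_{ij}.$$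
   Context: Consider a correlation clustering problem on $n$ nodes in which each pair of distinct nodes $(i,j)$ has non-negative weights $(w_{ij}^+,w_{ij}^-)$ (similarity and dissimilarity) of which exactly one is positive and the other is zero; $w_{ij}>0$ denotes the positive one. Set $d_{ij}=1$ if $w_{ij}^->0$ (dissimilar pair) and $d_{ij}=0$ if $w_{ij}^+>0$ (similar pair), and $b_{ijk}=-d_{ij}+d_{ik}+d_{jk}$. The variables are real numbers $y_{ij},m_{ij}$ indexed by unordered pairs of distinct nodes (symmetric in $i,j$); $y_{ij}$ plays the role of $x_{ij}-d_{ij}$ where $x_{ij}$ is a distance variable satisfying the triangle inequalities $x_{ij}\le x_{ik}+x_{jk}$. ''For all $i,j$'' ranges over pairs of distinct nodes and ''for all $i,j,k$'' over ordered triples of distinct nodes. *)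

(* Defs.v *)
From mathcomp Require Import all_boot all_order all_algebra.
From mathcomp Require Import reals.

Set Implicit Arguments.
Unset Strict Implicit.
Unset Printing Implicit Defensive.

Import Order.TTheory GRing.Theory Num.Theory.
Local Open Scope ring_scope.

(* A family of reals indexed by unordered pairs of distinct nodes is encoded as
   a function of two nodes f with [commutative f], i.e. f i j = f j i for all
   i, j. The values f i i on the diagonal are junk: no constraint or objective
   below reads them. *)
Definition pair_family (R : realType) (n : nat) := 'I_n -> 'I_n -> R.

Definition correlation_weights (R : realType) (n : nat)
    (wp wm : pair_family R n) : Prop :=
  [/\ commutative wp, commutative wm &
      forall i j, i != j ->
        (0 < wp i j /\ wm i j = 0) \/ (wp i j = 0 /\ 0 < wm i j)].

Definition weight (R : realType) (n : nat)
    (wp wm : pair_family R n) : pair_family R n :=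
  fun i j => if 0 < wp i j then wp i j else wm i j.

Definition dissim (R : realType) (n : nat)
    (wm : pair_family R n) : pair_family R n :=
  fun i j => if 0 < wm i j then 1 else 0.

Definition rhs (R : realType) (n : nat) (d : pair_family R n)
    (i j k : 'I_n) : R :=
  - d i j + d i k + d j k.

Definition pair_sum (R : realType) (n : nat) (f : pair_family R n) : R :=
  \sum_(i < n) \sum_(j < n | (i < j)%N) f i j.

Definition feasible (R : realType) (n : nat) (d m y : pair_family R n) : Prop :=
  [/\ commutative m, commutative y,
      (forall i j k, i != j -> i != k -> j != k ->
         y i j - y i k - y j k <= rhs d i j k) &
      (forall i j, i != j -> y i j <= m i j /\ - y i j <= m i j)].

Definition lp_objective (R : realType) (n : nat)
    (w m : pair_family R n) : R :=
  pair_sum (fun i j => w i j * m i j).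

Definition qp_objective (R : realType) (n : nat) (gamma : R)
    (w m y : pair_family R n) : R :=
  pair_sum (fun i j => w i j * m i j)
  + 1 / (2 * gamma) * pair_sum (fun i j => w i j * m i j ^+ 2)
  + 1 / (2 * gamma) * pair_sum (fun i j => w i j * y i j ^+ 2).

Definition lp_optimal (R : realType) (n : nat)
    (d w m y : pair_family R n) : Prop :=
  feasible d m y /\
  forall m' y', feasible d m' y' -> lp_objective w m <= lp_objective w m'.

Definition qp_optimal (R : realType) (n : nat) (gamma : R)
    (d w m y : pair_family R n) : Prop :=
  feasible d m y /\
  forall m' y', feasible d m' y' ->
    qp_objective gamma w m y <= qp_objective gamma w m' y'.

(* Main.v *)
Require Import Defs.
From mathcomp Require Import all_boot all_order all_algebra.
From mathcomp Require Import reals.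
From mathcomp Require Import ring lra.

Import Order.TTheory GRing.Theory Num.Theory.
Local Open Scope ring_scope.

(** The lower bound is optimality of the LP solution, since the two programs
    have the same feasible set.

    For the upper bound, let x = y + d be the distances of any feasible point
    (m, y), and let c be the truncation of the real line to [0, 1]. As c is
    nondecreasing and subadditive, c(x) still satisfies the triangle
    inequalities; as c is 1-Lipschitz and fixes d, which is 0 or 1, the
    truncated offset y' = c(x) - d satisfies |y'| <= |y| <= m. So (|y'|, y') is
    feasible and costs no more than (m, y) in the LP ([feasible_truncated],
    [truncated_offset_le]). Moreover |y'| <= 1, hence |y'|^2 <= |y'|, and each
    of the two quadratic terms of the QP at (|y'|, y') is at most 1 / (2 gamma)
    times its linear term ([qp_objective_norm_le]). Since both quadratic terms
    are nonnegative, the linear cost of the QP optimum is at most the QP value,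
    which is at most the QP value at (|y'|, y'), hence at most (1 + 1 / gamma)
    times the LP cost of (m, y). *)

Section PairSum.

Context {R : realType} {n : nat}.
Implicit Types f g : pair_family R n.

Lemma le_pair_sum f g :
  (forall i j, i != j -> f i j <= g i j) -> pair_sum f <= pair_sum g.
Proof.
move=> fg; apply: ler_sum => i _; apply: ler_sum => j ij.
by apply: fg; rewrite -val_eqE neq_ltn ij.
Qed.

Lemma pair_sum_ge0 f : (forall i j, i != j -> 0 <= f i j) -> 0 <= pair_sum f.
Proof.
move=> f0; apply: sumr_ge0 => i _; apply: sumr_ge0 => j ij.
by apply: f0; rewrite -val_eqE neq_ltn ij.
Qed.

End PairSum.

Section Truncation.

Context {R : realType}.
Implicit Types a b c d x : R.

Definition truncate x := Num.min 1 (Num.max 0 x).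

(** With b and c replaced by their positive parts the hypothesis persists for
    the positive part of a, and capping at 1 is harmless: if the cap is reached
    on the right, the right-hand side is already at least 1. *)
Lemma truncate_triangle a b c :
  a <= b + c -> truncate a <= truncate b + truncate c.
Proof.
rewrite /truncate => abc.
case: (leP 0 a) => ?; case: (leP 0 b) => ?; case: (leP 0 c) => ?;
  rewrite ?(min_r ler01) //; case: (leP 1 a) => ?; case: (leP 1 b) => ?;
  case: (leP 1 c) => ?; lra.
Qed.

(** Truncation is 1-Lipschitz and fixes both values of d. *)
Lemma truncate_dist_le d x : d = 0 \/ d = 1 -> `|truncate x - d| <= `|x - d|.
Proof.
rewrite /truncate => -[] ->; case: (leP 0 x) => ?;
  rewrite ?(min_r ler01); try case: (leP 1 x) => ?;
  case: (ger0P (_ - _)) => ?; try case: (ger0P (x - _)) => ?; lra.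
Qed.

Lemma truncate_dist_le1 d x : d = 0 \/ d = 1 -> `|truncate x - d| <= 1.
Proof.
rewrite /truncate => -[] ->; case: (leP 0 x) => ?;
  rewrite ?(min_r ler01); try case: (leP 1 x) => ?;
  case: (ger0P (_ - _)) => ?; lra.
Qed.

End Truncation.

Section Clustering.

Context {R : realType} {n : nat}.
Implicit Types w d m y : pair_family R n.

Lemma weight_ge0 {wp wm : pair_family R n} : correlation_weights wp wm ->
  forall i j, i != j -> 0 <= weight wp wm i j.
Proof.
move=> [_ _ h] i j /h; rewrite /weight; case: ifP => [/ltW //|_].
by case=> [[_ ->]|[_ /ltW]].
Qed.

Lemma dissim01 (wm : pair_family R n) i j :
  dissim wm i j = 0 \/ dissim wm i j = 1.
Proof. by rewrite /dissim; case: ifP; [right|left]. Qed.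

Definition truncated_offset d y : pair_family R n :=
  fun i j => truncate (y i j + d i j) - d i j.

Definition norm_family y : pair_family R n := fun i j => `|y i j|.

Lemma truncated_offset_le d m y i j : (forall i j, d i j = 0 \/ d i j = 1) ->
  feasible d m y -> i != j -> norm_family (truncated_offset d y) i j <= m i j.
Proof.
move=> d01 [_ _ _ ym] /ym [ym1 ym2].
apply: le_trans (truncate_dist_le _ (y i j + d i j) (d01 i j)) _.
by rewrite addrK ler_norml ym1 andbT lerNl.
Qed.

(** Adding d turns the constraint with right-hand side [rhs] into the triangle
    inequality for the distances y + d, which truncation preserves. *)
Lemma feasible_truncated d m y : commutative d -> feasible d m y ->
  feasible d (norm_family (truncated_offset d y)) (truncated_offset d y).
Proof.
move=> dC [_ yC tri _]; split.
- by move=> i j; rewrite /norm_family /truncated_offset yC dC.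
- by move=> i j; rewrite /truncated_offset yC dC.
- move=> i j k ij ik jk; have := tri i j k ij ik jk.
  rewrite /truncated_offset /rhs => h.
  have : y i j + d i j <= (y i k + d i k) + (y j k + d j k) by lra.
  by move/truncate_triangle; lra.
- by move=> i j _; rewrite /norm_family ler_norm -normrN ler_norm.
Qed.

Lemma lp_le_qp_objective (gamma : R) w m y : 0 < gamma ->
  (forall i j, i != j -> 0 <= w i j) ->
  lp_objective w m <= qp_objective gamma w m y.
Proof.
move=> g0 w0; rewrite /qp_objective -addrA lerDl.
have g20 : 0 <= 1 / (2 * gamma) by rewrite divr_ge0 // mulr_ge0 // ltW.
by rewrite addr_ge0 // mulr_ge0 // pair_sum_ge0 // => i j /w0 wij;
  rewrite mulr_ge0 ?sqr_ge0.
Qed.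

(** Values in [0, 1] dominate their squares, so each quadratic term costs at
    most half of the extra 1 / gamma. *)
Lemma qp_objective_norm_le (gamma : R) w y : 0 < gamma ->
  (forall i j, i != j -> 0 <= w i j) -> (forall i j, norm_family y i j <= 1) ->
  qp_objective gamma w (norm_family y) y
    <= (1 + 1 / gamma) * lp_objective w (norm_family y).
Proof.
move=> g0 w0 y1.
have sq_le i j : `|y i j| ^+ 2 <= `|y i j|.
  by rewrite expr2 ler_piMr // y1.
have g20 : 0 <= 1 / (2 * gamma) by rewrite divr_ge0 // mulr_ge0 // ltW.
have -> : 1 + 1 / gamma = 1 + 1 / (2 * gamma) + 1 / (2 * gamma).
  by field; rewrite gt_eqF.
rewrite [leRHS]mulrDl [X in _ <= X + _]mulrDl mul1r /qp_objective.
apply: lerD; [apply: lerD => //|]; apply: ler_wpM2l => //;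
  apply: le_pair_sum => i j /w0 wij; apply: ler_wpM2l => //.
  exact: sq_le.
by rewrite -real_normK ?num_real //; apply: sq_le.
Qed.

End Clustering.

Theorem theorem3 (R : realType) (n : nat) (wp wm : pair_family R n) (gamma : R)
    (ms ys mh yh : pair_family R n)
    (hw : correlation_weights wp wm)
    (hgamma : 0 < gamma)
    (hlp : lp_optimal (dissim wm) (weight wp wm) ms ys)
    (hqp : qp_optimal gamma (dissim wm) (weight wp wm) mh yh) :
  pair_sum (fun i j => weight wp wm i j * ms i j)
    <= pair_sum (fun i j => weight wp wm i j * mh i j) /\
  pair_sum (fun i j => weight wp wm i j * mh i j)
    <= (1 + 1 / gamma) * pair_sum (fun i j => weight wp wm i j * ms i j).
Proof.
have [feas_s opt_s] := hlp; have [feas_h opt_h] := hqp.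
split; first exact: (opt_s mh yh).
have w0 := weight_ge0 hw.
have d01 := dissim01 wm.
have dC : commutative (dissim wm).
  by case: hw => _ wmC _ i j; rewrite /dissim wmC.
set y' := truncated_offset (dissim wm) ys.
apply: le_trans (lp_le_qp_objective gamma _ mh yh hgamma w0) _.
apply: le_trans (opt_h _ _ (feasible_truncated _ _ _ dC feas_s)) _.
apply: le_trans (qp_objective_norm_le gamma _ y' hgamma w0 _) _.
  by move=> i j; apply: truncate_dist_le1.
apply: ler_wpM2l; first by rewrite addr_ge0 // divr_ge0 // ltW.
apply: le_pair_sum => i j ij; apply: ler_wpM2l; first exact: w0.
exact: truncated_offset_le _ _ _ _ _ d01 feas_s ij.
Qed.
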